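(* Let $\varphi:\mathbb{S}^2\to\mathbb{S}^n$ be a full quadratic form, and assume that $\varphi$ is homothetic. Then $\varphi$ is proper biharmonic if and only if $n=5$, the image $\varphi(\mathbb{S}^2)$ is contained in a small hypersphere $\mathbb{S}^4(1/\sqrt2)$ of radius $1/\sqrt2$ of $\mathbb{S}^5$, and, up to homothetic changes of domain and codomain, the map $\psi:\mathbb{S}^2\to\mathbb{S}^4(1/\sqrt2)$ determined by $\varphi$ is the Veronese map.
   Context: $\mathbb{S}^k(r)$ denotes the $k$-dimensional Euclidean sphere of radius $r$ with its standard metric, and $\mathbb{S}^k=\mathbb{S}^k(1)\subset\mathbb{R}^{k+1}$. A small hypersphere $\mathbb{S}^{n-1}(r)$ of $\mathbb{S}^n$, $0<r<1$, is the intersection of $\mathbb{S}^n$ with an affine hyperplane of $\mathbb{R}^{n+1}$ at distance $\sqrt{1-r^2}$ from the origin. If $\varphi$ takes values in it, $\psi$ denotes $\varphi$ regarded as a map into that hypersphere. A quadratic form $\varphi:\mathbb{S}^m\to\mathbb{S}^n$ is the restriction to $\mathbb{S}^m$ of a map $F:\mathbb{R}^{m+1}\to\mathbb{R}^{n+1}$ all of whose components are homogeneous polynomials of degree $2$ and which satisfies $|F(\overline x)|=1$ whenever $|\overline x|=1$; quadratic forms are assumed non-constant. A map into $\mathbb{S}^n$ is full if its image is not contained in any totally geodesic hypersphere of $\mathbb{S}^n$ (i.e. in any linear hyperplane of $\mathbb{R}^{n+1}$). A map $\varphi:(M,g)\to(N,h)$ is homothetic if $\varphi^*h=c\,g$ for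 some constant $c>0$. The Veronese map is the map $\mathbb{S}^2(\sqrt3)\to\mathbb{S}^4$ given by $$(x,y,z)\mapsto\left(\tfrac{xy}{\sqrt3},\tfrac{xz}{\sqrt3},\tfrac{yz}{\sqrt3},\tfrac{x^2-y^2}{2\sqrt3},\tfrac{x^2+y^2-2z^2}{6}\right).$$ ''Up to homothetic changes of domain and codomain'' means up to composition with homothetic diffeomorphisms (isometries and rescalings) between round spheres on the domain and on the codomain. The tension field of a smooth map $\varphi:(M,g)\to(N,h)$ is $\tau(\varphi)=\mathrm{trace}\,\nabla d\varphi$; $\varphi$ is harmonic if $\tau(\varphi)=0$. For $M$ compact, $\varphi$ is biharmonic if it is a critical point of the bienergy $E_2(\varphi)=\frac12\int_M|\tau(\varphi)|^2\,v_g$; equivalently, $\tau_2(\varphi)=-\Delta\tau(\varphi)-\mathrm{trace}\,R^N(d\varphi(\cdot),\tau(\varphi))d\varphi(\cdot)=0$, where $\Delta\sigma=-\mathrm{trace}\,\nabla^2\sigma$ and $R(X,Y)Z=\nabla_X\nabla_YZ-\nabla_Y\nabla_XZ-\nabla_{[X,Y]}Z$. A map is proper biharmonic if it is biharmonic but not harmonic. *)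

(* Defs.v *)
From HB Require Import structures.
From mathcomp Require Export all_boot all_order all_algebra.
From mathcomp Require Export all_classical all_reals all_analysis.
Set Implicit Arguments.
Unset Strict Implicit.
Unset Printing Implicit Defensive.
Export Order.TTheory GRing.Theory Num.Theory.
Export numFieldNormedType.Exports.
Local Open Scope classical_set_scope.
Local Open Scope ring_scope.

(* Maps between spheres are total functions between the ambient spaces
   'rV[R]_k.+1; only their values on the sphere are meaningful, and every notion
   below depends only on those values.  The normed structure of 'rV[R]_k.+1 in
   the library is the sup norm; it only serves to define limits, the metric
   being the Euclidean one given by [dot]. *)

Definition dot (R : realType) (k : nat) (u v : 'rV[R]_k) : R :=
  \sum_(i < k) u 0 i * v 0 i.

Definition enorm (R : realType) (k : nat) (u : 'rV[R]_k) : R :=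
  Num.sqrt (dot u u).

Definition esphere (R : realType) (k : nat) (r : R) : set 'rV[R]_k.+1 :=
  [set x | enorm x = r].
Arguments esphere {R} k r _.

Definition tangent (R : realType) (k : nat) (x u : 'rV[R]_k.+1) : Prop :=
  dot x u = 0.

Definition sretract (R : realType) (k : nat) (r : R) (y : 'rV[R]_k.+1)
  : 'rV[R]_k.+1 := (r / enorm y) *: y.

(* Directional derivative at x in S^k(r) of a vector-valued map on S^k(r), in
   the tangent direction u: the radial retraction R^(k+1) \ {0} -> S^k(r) is
   smooth and its differential at x is the identity on the tangent space. *)
Definition sderive (R : realType) (k l : nat) (r : R)
    (f : 'rV[R]_k.+1 -> 'rV[R]_l.+1) (x u : 'rV[R]_k.+1) : 'rV[R]_l.+1 :=
  'D_u (fun y => f (sretract r y)) x.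

Fixpoint Ck_on (R : realType) (k l : nat) (N : nat) (U : set 'rV[R]_k.+1)
    (f : 'rV[R]_k.+1 -> 'rV[R]_l.+1) : Prop :=
  match N with
  | 0%N => forall x, U x -> {for x, continuous f}
  | N'.+1 => forall v, (forall x, U x -> derivable f x v) /\
                       Ck_on N' U (fun x => 'D_v f x)
  end.

Definition smooth_on_sphere (R : realType) (k l : nat) (r : R)
    (f : 'rV[R]_k.+1 -> 'rV[R]_l.+1) : Prop :=
  exists (U : set 'rV[R]_k.+1) (G : 'rV[R]_k.+1 -> 'rV[R]_l.+1),
    [/\ open U, esphere k r `<=` U, forall N, Ck_on N U G
      & forall x, esphere k r x -> f x = G x].

(* The pull-back of the codomain metric is a constant positive multiple of the
   metric of S^k(r). *)
Definition homothetic (R : realType) (k l : nat) (r : R)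
    (f : 'rV[R]_k.+1 -> 'rV[R]_l.+1) : Prop :=
  exists2 c : R, 0 < c & forall x u v,
    esphere k r x -> tangent x u -> tangent x v ->
    dot (sderive r f x u) (sderive r f x v) = c * dot u v.

Definition homothetic_diffeo (R : realType) (k l : nat) (r s : R)
    (f : 'rV[R]_k.+1 -> 'rV[R]_l.+1) : Prop :=
  (exists g : 'rV[R]_l.+1 -> 'rV[R]_k.+1,
    [/\ forall x, esphere k r x -> esphere l s (f x) /\ g (f x) = x,
        forall y, esphere l s y -> esphere k r (g y) /\ f (g y) = y,
        smooth_on_sphere r f
      & smooth_on_sphere s g]) /\
  homothetic r f.

Definition quadratic_map (R : realType) (m n : nat)
    (F : 'rV[R]_m.+1 -> 'rV[R]_n.+1) : Prop :=
  exists a : 'I_n.+1 -> 'I_m.+1 -> 'I_m.+1 -> R, forall x k,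
    F x 0 k = \sum_(i < m.+1) \sum_(j < m.+1) a k i j * x 0 i * x 0 j.

Definition quadratic_form (R : realType) (m n : nat)
    (phi : 'rV[R]_m.+1 -> 'rV[R]_n.+1) : Prop :=
  (exists F : 'rV[R]_m.+1 -> 'rV[R]_n.+1,
    [/\ quadratic_map F,
        forall x, enorm x = 1 -> enorm (F x) = 1
      & forall x, esphere m 1 x -> phi x = F x]) /\
  (exists x y, [/\ esphere m 1 x, esphere m 1 y & phi x <> phi y]).

Definition full_map (R : realType) (m n : nat)
    (phi : 'rV[R]_m.+1 -> 'rV[R]_n.+1) : Prop :=
  forall a : 'rV[R]_n.+1, a != 0 ->
    ~ (forall x, esphere m 1 x -> dot (phi x) a = 0).

Definition tproj (R : realType) (n : nat) (p v : 'rV[R]_n.+1) : 'rV[R]_n.+1 :=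
  v - dot v p *: p.

Definition vfield (R : realType) (n : nat) := 'rV[R]_n.+1 -> 'rV[R]_n.+1.

(* As S^n is isometrically embedded, its Levi-Civita connection is the
   tangential part of the flat derivative. *)
Definition LC (R : realType) (n : nat) (X Y : vfield R n) : vfield R n :=
  fun p => tproj p (sderive 1 Y p (X p)).

Definition bracket (R : realType) (n : nat) (X Y : vfield R n) : vfield R n :=
  fun p => sderive 1 Y p (X p) - sderive 1 X p (Y p).

Definition curvature_field (R : realType) (n : nat) (X Y Z : vfield R n)
  : vfield R n :=
  fun p => LC X (LC Y Z) p - LC Y (LC X Z) p - LC (bracket X Y) Z p.

(* The tangent vector field on the sphere obtained by projecting a constant
   vector; it extends v when v is tangent at the point considered. *)
Definition tfield (R : realType) (n : nat) (v : 'rV[R]_n.+1) : vfield R n :=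
  fun p => tproj p v.

Definition curvature (R : realType) (n : nat) (p u v w : 'rV[R]_n.+1)
  : 'rV[R]_n.+1 := curvature_field (tfield u) (tfield v) (tfield w) p.

Definition pushforward (R : realType) (m n : nat)
    (phi : 'rV[R]_m.+1 -> 'rV[R]_n.+1) (X : vfield R m)
  : 'rV[R]_m.+1 -> 'rV[R]_n.+1 :=
  fun x => sderive 1 phi x (X x).

Definition pullback_conn (R : realType) (m n : nat)
    (phi : 'rV[R]_m.+1 -> 'rV[R]_n.+1) (X : vfield R m)
    (sigma : 'rV[R]_m.+1 -> 'rV[R]_n.+1) : 'rV[R]_m.+1 -> 'rV[R]_n.+1 :=
  fun x => tproj (phi x) (sderive 1 sigma x (X x)).

Definition second_fundamental_form (R : realType) (m n : nat)
    (phi : 'rV[R]_m.+1 -> 'rV[R]_n.+1) (X Y : vfield R m)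
  : 'rV[R]_m.+1 -> 'rV[R]_n.+1 :=
  fun x => pullback_conn phi X (pushforward phi Y) x - pushforward phi (LC X Y) x.

Definition second_cov_derivative (R : realType) (m n : nat)
    (phi sigma : 'rV[R]_m.+1 -> 'rV[R]_n.+1) (X Y : vfield R m)
  : 'rV[R]_m.+1 -> 'rV[R]_n.+1 :=
  fun x => pullback_conn phi X (pullback_conn phi Y sigma) x
           - pullback_conn phi (LC X Y) sigma x.

(* Trace over T_x S^m of a bilinear expression b, tensorial in its arguments.
   The tangential projections of the standard basis (e_i) of R^(m+1) satisfy
   sum_i b(Pe_i, Pe_i) = sum_j b(f_j, f_j) for every orthonormal basis (f_j) of
   T_x S^m. *)
Definition strace (R : realType) (m n : nat)
    (b : vfield R m -> vfield R m -> 'rV[R]_m.+1 -> 'rV[R]_n.+1)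
    (x : 'rV[R]_m.+1) : 'rV[R]_n.+1 :=
  \sum_(i < m.+1) b (tfield (delta_mx 0 i)) (tfield (delta_mx 0 i)) x.

Definition tension (R : realType) (m n : nat)
    (phi : 'rV[R]_m.+1 -> 'rV[R]_n.+1) : 'rV[R]_m.+1 -> 'rV[R]_n.+1 :=
  strace (second_fundamental_form phi).

Definition rough_laplacian (R : realType) (m n : nat)
    (phi sigma : 'rV[R]_m.+1 -> 'rV[R]_n.+1) : 'rV[R]_m.+1 -> 'rV[R]_n.+1 :=
  fun x => - strace (second_cov_derivative phi sigma) x.

Definition bitension (R : realType) (m n : nat)
    (phi : 'rV[R]_m.+1 -> 'rV[R]_n.+1) : 'rV[R]_m.+1 -> 'rV[R]_n.+1 :=
  fun x => - rough_laplacian phi (tension phi) x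
    - strace (fun X Y y => curvature (phi y) (pushforward phi X y)
                             (tension phi y) (pushforward phi Y y)) x.

Definition harmonic_map (R : realType) (m n : nat)
    (phi : 'rV[R]_m.+1 -> 'rV[R]_n.+1) : Prop :=
  forall x, esphere m 1 x -> tension phi x = 0.

(* Euler-Lagrange equation of the bienergy. *)
Definition biharmonic (R : realType) (m n : nat)
    (phi : 'rV[R]_m.+1 -> 'rV[R]_n.+1) : Prop :=
  forall x, esphere m 1 x -> bitension phi x = 0.

Definition proper_biharmonic (R : realType) (m n : nat)
    (phi : 'rV[R]_m.+1 -> 'rV[R]_n.+1) : Prop :=
  biharmonic phi /\ ~ harmonic_map phi.

(* nu is meant to be a unit vector and 0 < r < 1. *)
Definition small_hypersphere (R : realType) (n : nat) (nu : 'rV[R]_n.+1) (r : R)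
  : set 'rV[R]_n.+1 :=
  [set y | esphere n 1 y /\ dot y nu = Num.sqrt (1 - r ^+ 2)].

(* psi is phi regarded as a map into the small hypersphere, identified with
   S^(n-1)(r) in R^n by z |-> z E + sqrt (1 - r^2) nu, where the rows of E form
   an orthonormal basis of the orthogonal complement of nu.  As n may be 0, R^n
   is written 'rV_(n.-1.+1). *)
Definition hypersphere_coordinates (R : realType) (m n : nat)
    (nu : 'rV[R]_n.+1) (r : R) (E : 'M[R]_(n.-1.+1, n.+1))
    (phi : 'rV[R]_m.+1 -> 'rV[R]_n.+1)
    (psi : 'rV[R]_m.+1 -> 'rV[R]_n.-1.+1) : Prop :=
  [/\ E *m E^T = 1%:M,
      E *m nu^T = 0
    & forall x, esphere m 1 x -> esphere n.-1 r (psi x) /\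
        phi x = psi x *m E + Num.sqrt (1 - r ^+ 2) *: nu].

Definition veronese (R : realType) (p : 'rV[R]_3) : 'rV[R]_5 :=
  let x := p 0 0 in
  let y := p 0 1 in
  let z := p 0 2 in
  \row_(i < 5) nth 0
    [:: x * y / Num.sqrt 3;
        x * z / Num.sqrt 3;
        y * z / Num.sqrt 3;
        (x ^+ 2 - y ^+ 2) / (2 * Num.sqrt 3);
        (x ^+ 2 + y ^+ 2 - 2 * z ^+ 2) / 6] i.

Definition veronese_up_to_homothety (R : realType) (l : nat) (r : R)
    (psi : 'rV[R]_3 -> 'rV[R]_l.+1) : Prop :=
  exists (alpha : 'rV[R]_3 -> 'rV[R]_3) (beta : 'rV[R]_l.+1 -> 'rV[R]_5),
    [/\ homothetic_diffeo (k := 2) (l := 2) (Num.sqrt 3) 1 alpha,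
        homothetic_diffeo (l := 4) r 1 beta
      & forall x, esphere 2 (Num.sqrt 3) x -> beta (psi (alpha x)) = veronese x].

(* Main.v *)
(* Write phi x = q x on the sphere, with q quadratic and polar form b, and let
   T be the sum of the q e_i (so T / 3 is the mean of phi).  The tension field
   of a quadratic form is 2 (T - <T, phi> phi).  If phi is homothetic with
   factor c, expanding |q (x + t u)|^2 = |x + t u|^4 shows that <T, phi> is
   constant, hence that phi lies in a small hypersphere; all terms of the
   bitension field are then multiples of the tension field, and on S^2 the
   biharmonic equation becomes c = 3/2, which is also the value forced by the
   radius 1/sqrt 2.  For this c the inner products of the b e_i e_j are all
   determined, and they say that the coefficients of phi on the five trace-free
   quadrics of the Veronese map are orthogonal of equal length. *)
Require Import Defs.
From mathcomp Require Import ring lra.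
Set Implicit Arguments.
Unset Strict Implicit.
Unset Printing Implicit Defensive.
Local Open Scope classical_set_scope.
Local Open Scope ring_scope.

(** * Euclidean scalar product and directional derivatives *)

Section DotProduct.
Variables (R : realType) (k : nat).
Implicit Types (u v w : 'rV[R]_k) (a : R).

Lemma dotC u v : dot u v = dot v u.
Proof. by apply: eq_bigr => i _; rewrite mulrC. Qed.

Lemma dotDl u v w : dot (u + v) w = dot u w + dot v w.
Proof. by rewrite -big_split; apply: eq_bigr => i _; rewrite mxE mulrDl. Qed.

Lemma dotZl a u v : dot (a *: u) v = a * dot u v.
Proof. by rewrite mulr_sumr; apply: eq_bigr => i _; rewrite mxE mulrA. Qed.

Lemma dotNl u v : dot (- u) v = - dot u v.
Proof. by rewrite -scaleN1r dotZl mulN1r. Qed.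

Lemma dotDr u v w : dot u (v + w) = dot u v + dot u w.
Proof. by rewrite ![dot u _]dotC dotDl. Qed.

Lemma dotZr a u v : dot u (a *: v) = a * dot u v.
Proof. by rewrite ![dot u _]dotC dotZl. Qed.

Lemma dotNr u v : dot u (- v) = - dot u v.
Proof. by rewrite ![dot u _]dotC dotNl. Qed.

Lemma dot0l u : dot 0 u = 0.
Proof. by rewrite -(scale0r 0) dotZl mul0r. Qed.

Lemma dot0r u : dot u 0 = 0.
Proof. by rewrite dotC dot0l. Qed.

Definition dotE := (dotDl, dotDr, dotZl, dotZr, dotNl, dotNr).

Lemma dot_sumr n u (f : 'I_n -> 'rV[R]_k) :
  dot u (\sum_(i < n) f i) = \sum_(i < n) dot u (f i).
Proof. by apply: (big_morph (dot u)) => [x y|]; rewrite ?dotDr ?dot0r. Qed.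

Lemma dot_delta u i : dot u (delta_mx 0 i) = u 0 i.
Proof.
rewrite /dot (bigD1 i) //= mxE !eqxx mulr1 big1 ?addr0 // => j ji.
by rewrite mxE (negPf ji) andbF mulr0.
Qed.

Lemma dot_ge0 u : 0 <= dot u u.
Proof. by apply: sumr_ge0 => i _; rewrite -expr2 sqr_ge0. Qed.

Lemma dot_eq0 u : (dot u u == 0) = (u == 0).
Proof.
apply/eqP/eqP => [u0|->]; last by rewrite dot0l.
apply/rowP => i; rewrite mxE; apply/eqP; rewrite -sqrf_eq0 expr2.
have h0 : forall j : 'I_k, true -> 0 <= u 0 j * u 0 j.
  by move=> j _; rewrite -expr2 sqr_ge0.
by rewrite (psumr_eq0P h0 u0).
Qed.

Lemma dot_mx u v : dot u v = (u *m v^T) 0 0.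
Proof. by rewrite mxE; apply: eq_bigr => i _; rewrite mxE. Qed.

Lemma enorm_sqr u : enorm u ^+ 2 = dot u u.
Proof. by rewrite sqr_sqrtr // dot_ge0. Qed.

Lemma enorm_ge0 u : 0 <= enorm u.
Proof. exact: sqrtr_ge0. Qed.

Lemma enormE a u : 0 <= a -> (enorm u = a) <-> (dot u u = a ^+ 2).
Proof.
move=> a0; split=> [<-|ua]; first by rewrite enorm_sqr.
by rewrite /enorm ua sqrtr_sqr ger0_norm.
Qed.

Lemma enormZ a u : 0 <= a -> enorm (a *: u) = a * enorm u.
Proof.
move=> a0; apply/enormE; first by rewrite mulr_ge0 ?enorm_ge0.
by rewrite exprMn enorm_sqr dotZl dotZr mulrA expr2.
Qed.

Lemma enorm_gt0 u : (0 < enorm u) = (u != 0).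
Proof. by rewrite sqrtr_gt0 lt_def dot_ge0 andbT dot_eq0. Qed.

End DotProduct.

Lemma dot_mulmx (R : realType) (k n : nat) (A : 'M[R]_(n, k)) u v :
  dot (v *m A) u = dot v (u *m A^T).
Proof. by rewrite !dot_mx trmx_mul trmxK mulmxA. Qed.

Section DirectionalDerivative.
Variables (R : realType) (V : normedModType R).
Implicit Types (x u : V).

Lemma is_derive_rVP (l : nat) (f : V -> 'rV[R]_l) x u (d : 'rV[R]_l) :
  is_derive x u f d <-> forall i, is_derive x u (fun y => f y 0 i) (d 0 i).
Proof.
split=> [[fx <-] i|fd].
  split; first by move/derivable_mxP : fx; exact.
  by rewrite derive_mx // mxE.
have fx : derivable f x u.
  by apply/derivable_mxP => i j; rewrite ord1; case: (fd j).
split=> //; rewrite derive_mx //; apply/rowP => i; rewrite mxE.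
by case: (fd i).
Qed.

Lemma is_derive_scale (l : nat) (s : V -> R) (f : V -> 'rV[R]_l) x u ds df :
  is_derive x u s ds -> is_derive x u f df ->
  is_derive x u (fun y => s y *: f y) (s x *: df + ds *: f x).
Proof.
move=> ss /is_derive_rVP ff; apply/is_derive_rVP => i.
rewrite (_ : (fun y => _) = s * (fun y => f y 0 i)); last first.
  by apply/funext => y; rewrite mxE.
by apply: is_derive_eq; rewrite /GRing.scale /= !mxE [ds * _]mulrC.
Qed.

Lemma is_derive_dot (l : nat) (f g : V -> 'rV[R]_l) x u df dg :
  is_derive x u f df -> is_derive x u g dg ->
  is_derive x u (fun y => dot (f y) (g y)) (dot df (g x) + dot (f x) dg).
Proof.
move=> /is_derive_rVP ff /is_derive_rVP gg.
rewrite (_ : (fun y => _) =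
    \sum_(i < l) (fun y => f y 0 i) * (fun y => g y 0 i)); last first.
  by apply/funext => y; rewrite fct_sumE.
apply: is_derive_eq; rewrite -big_split; apply: eq_bigr => i _ /=.
by rewrite /GRing.scale /= addrC [g x 0 i * _]mulrC.
Qed.

(** Restricting to a line turns a directional derivative into an ordinary one, which opens the way
    to the one-variable chain rule. *)
Lemma is_derive_line (f : V -> R) x u df :
  is_derive x u f df <-> is_derive (0 : R) 1 (fun t => f (t *: u + x)) df.
Proof.
have line : 'D_u f x = 'D_1 (fun t : R => f (t *: u + x)) 0.
  rewrite /derive; set g1 := fun h => h^-1 *: _; set g2 := fun h => h^-1 *: _.
  suff -> : g1 = g2 by [].
  by rewrite funeqE /g1 /g2 => h /=; rewrite addr0 scale0r add0r [_%:A]mulr1.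
by split=> -[fx <-]; split; rewrite ?line //; apply/(derivable1P f x u).
Qed.

Lemma is_derive_comp1 (f : V -> R) (g : R -> R) x u df dg :
  is_derive x u f df -> is_derive (f x) 1 g dg ->
  is_derive x u (fun y => g (f y)) (dg * df).
Proof.
move=> /is_derive_line fx gx; apply/is_derive_line.
apply: (@is_derive1_comp _ g (fun t => f (t *: u + x))).
by rewrite scale0r add0r.
Qed.

End DirectionalDerivative.

(** * Calculus on spheres *)

Section SphereDerivative.
Variables (R : realType) (k : nat) (r : R).
Hypothesis r0 : 0 < r.
Implicit Types (x u y : 'rV[R]_k.+1).

Lemma esphereP x : esphere k r x <-> dot x x = r ^+ 2.
Proof. exact/enormE/ltW. Qed.

Lemma esphere_neq0 x : esphere k r x -> x != 0.
Proof. by move=> xr; rewrite -enorm_gt0 xr. Qed.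

Lemma sretract_in y : y != 0 -> esphere k r (sretract r y).
Proof.
rewrite -enorm_gt0 => y0.
by rewrite /esphere /sretract /= enormZ ?divfK ?divr_ge0 ?gt_eqF // ltW.
Qed.

Lemma sretract_id x : esphere k r x -> sretract r x = x.
Proof. by move=> xr; rewrite /sretract xr divff ?gt_eqF // scale1r. Qed.

(** Relational form of [sderive] carrying derivability with the value; the target is any normed
    module, so inner products are covered too. *)
Definition is_sderive (W : normedModType R) (f : 'rV[R]_k.+1 -> W) x u d :=
  is_derive x u (fun y => f (sretract r y)) d.

(** Points near [x] are nonzero, so [sretract] sends them to the sphere, where [f] and [g] agree. A
    map can thus be differentiated through any formula valid on the sphere alone. *)
Lemma is_sderive_ext (W : normedModType R) (f g : 'rV[R]_k.+1 -> W) x u d :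
  esphere k r x -> (forall y, esphere k r y -> f y = g y) ->
  is_sderive g x u d -> is_sderive f x u d.
Proof.
move=> xr fg; apply: near_eq_is_derive.
have : \forall y \near x, y != 0.
  near=> y; rewrite -normr_gt0; near: y.
  have x0 : 0 < `|x| by rewrite normr_gt0 esphere_neq0.
  by apply: cvgr_gt x0; exact: norm_continuous.
by apply: filterS => y y0; rewrite fg //; exact: sretract_in.
Unshelve. all: by end_near. Qed.

Lemma is_sderive_id x u :
  esphere k r x -> tangent x u -> is_sderive id x u u.
Proof.
move=> xr xu; rewrite /is_sderive.
have dxx : dot x x = r ^+ 2 by apply/esphereP.
have dd : is_derive x u (fun y => dot y y) (dot u x + dot x u).
  by apply: is_derive_dot; exact: is_derive_id.
have ds : is_derive (dot x x) 1 Num.sqrt (2 * Num.sqrt (dot x x))^-1.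
  by apply: is_derive1_sqrt; rewrite dxx exprn_gt0.
have dn := is_derive_comp1 dd ds.
have di : is_derive (enorm x) 1 (fun t : R => t^-1) (- (enorm x) ^- 2 *: 1).
  by apply: is_deriveV; rewrite xr gt_eqF.
have dk := is_derive_comp1 dn di.
(* The radial factor is stationary, because [dot y y] has derivative [2 * dot x u = 0] in a tangent
   direction. *)
have dz : is_derive x u (fun y => r / enorm y) 0.
  apply: is_derive_eq (is_deriveZ r dk) _.
  by rewrite dotC xu addr0 !mulr0 scaler0.
apply: is_derive_eq (is_derive_scale dz (is_derive_id x u)) _.
by rewrite scale0r addr0 xr divff ?gt_eqF // scale1r.
Qed.

Section Rules.
Variables (x u : 'rV[R]_k.+1).
Hypothesis xr : esphere k r x.

Lemma is_sderive_cst (W : normedModType R) (a : W) : is_sderive (fun=> a) x u 0.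
Proof. exact: is_derive_cst. Qed.

Lemma is_sderiveB (W : normedModType R) (f g : 'rV[R]_k.+1 -> W) df dg :
  is_sderive f x u df -> is_sderive g x u dg ->
  is_sderive (fun y => f y - g y) x u (df - dg).
Proof. exact: is_deriveB. Qed.

Lemma is_sderiveZ (W : normedModType R) (a : R) (f : 'rV[R]_k.+1 -> W) df :
  is_sderive f x u df -> is_sderive (fun y => a *: f y) x u (a *: df).
Proof. exact: is_deriveZ. Qed.

Lemma is_sderive_scale l (s : 'rV[R]_k.+1 -> R) (f : 'rV[R]_k.+1 -> 'rV[R]_l)
    ds df :
  is_sderive s x u ds -> is_sderive f x u df ->
  is_sderive (fun y => s y *: f y) x u (s x *: df + ds *: f x).
Proof.
move=> ss ff; apply: is_derive_eq (is_derive_scale ss ff) _.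
by rewrite sretract_id.
Qed.

Lemma is_sderive_dot l (f g : 'rV[R]_k.+1 -> 'rV[R]_l) df dg :
  is_sderive f x u df -> is_sderive g x u dg ->
  is_sderive (fun y => dot (f y) (g y)) x u (dot df (g x) + dot (f x) dg).
Proof.
move=> ff gg; apply: is_derive_eq (is_derive_dot ff gg) _.
by rewrite sretract_id.
Qed.

End Rules.

Lemma sderiveE l (f : 'rV[R]_k.+1 -> 'rV[R]_l.+1) x u d :
  is_sderive f x u d -> sderive r f x u = d.
Proof. by case. Qed.

End SphereDerivative.

(** * Tangential projection, connection and curvature of the unit sphere *)

Section SphereGeometry.
Variables (R : realType) (n : nat).
Implicit Types (p u v w z : 'rV[R]_n.+1) (X : vfield R n).

Lemma tangent_tproj p v : esphere n 1 p -> tangent p (tproj p v).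
Proof.
by move=> /esphereP pp; rewrite /tangent !dotE pp // expr1n mulr1 dotC subrr.
Qed.

Lemma tproj_tangent p v : tangent p v -> tproj p v = v.
Proof. by move=> pv; rewrite /tproj dotC pv scale0r subr0. Qed.

Lemma tprojZ a p v : tproj p (a *: v) = a *: tproj p v.
Proof. by rewrite /tproj dotZl scalerBr scalerA. Qed.

Lemma tprojD p u v : tproj p (u + v) = tproj p u + tproj p v.
Proof. by rewrite /tproj dotDl scalerDl opprD addrACA. Qed.

Lemma tproj_self p : esphere n 1 p -> tproj p p = 0.
Proof. by move=> /esphereP pp; rewrite /tproj pp // expr1n scale1r subrr. Qed.

Lemma tproj0 p : tproj p 0 = 0.
Proof. by rewrite tproj_tangent // /tangent dot0r. Qed.

Lemma dot_tproj p v : esphere n 1 p ->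
  dot (tproj p v) (tproj p v) = dot v v - dot p v ^+ 2.
Proof.
by move=> /esphereP pp; rewrite !dotE pp // [dot p v]dotC; ring.
Qed.

Lemma is_sderive_tfield w p u : esphere n 1 p -> tangent p u ->
  is_sderive 1 (tfield w) p u (- (dot w p *: u + dot w u *: p)).
Proof.
move=> ps pu.
have did := is_sderive_id ltr01 ps pu.
have dw := is_sderive_cst 1 p u w.
have dd := is_sderive_dot ltr01 ps dw did.
apply: is_derive_eq (is_sderiveB dw (is_sderive_scale ltr01 ps dd did)) _.
by rewrite dot0l !add0r.
Qed.

(** The other term of the flat derivative, [- dot w (X p) *: p], is normal and is removed by the
    projection. *)
Lemma LC_tfield X w p : esphere n 1 p -> tangent p (X p) ->
  LC X (tfield w) p = - (dot w p *: X p).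
Proof.
move=> ps pX; rewrite /LC (sderiveE (is_sderive_tfield w ps pX)).
by rewrite -scaleN1r tprojZ tprojD !tprojZ tproj_self // scaler0 addr0
  tproj_tangent // scaleN1r.
Qed.

(** By [LC_tfield] the inner field is [- dot w y] times [tfield v y]; as [dot w p = 0], only the
    derivative of the coefficient survives at [p]. *)
Lemma LC_LC_tfield p u v w : esphere n 1 p ->
  tangent p u -> tangent p v -> tangent p w ->
  LC (tfield u) (LC (tfield v) (tfield w)) p = - (dot w u *: v).
Proof.
move=> ps pu pv pw; rewrite {1}/LC /tfield (tproj_tangent pu) -/tfield.
have dw := is_sderive_cst 1 p u w.
have did := is_sderive_id ltr01 ps pu.
have dd := is_sderive_dot ltr01 ps dw did.
have dv := is_sderive_tfield v ps pu.
have := is_sderive_scale ltr01 ps dd dv => /(is_sderiveZ (-1)) D.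
rewrite (sderiveE (is_sderive_ext ltr01 ps _ D)); last first.
  by move=> y ys; rewrite scaleN1r LC_tfield //; exact: tangent_tproj.
rewrite dotC pw scale0r !add0r dot0l add0r /tfield (tproj_tangent pv).
by rewrite scaleN1r tproj_tangent // /tangent !dotE pv mulr0 oppr0.
Qed.

Lemma curvatureE p u v w : esphere n 1 p ->
  tangent p u -> tangent p v -> tangent p w ->
  curvature p u v w = dot v w *: u - dot u w *: v.
Proof.
move=> ps pu pv pw; rewrite /curvature /curvature_field !LC_LC_tfield //.
(* Both flat derivatives are the same multiple of [p], by symmetry of [dot u v]. *)
have b0 : bracket (tfield u) (tfield v) p = 0.
  rewrite /bracket {2 4}/tfield !tproj_tangent //.
  rewrite (sderiveE (is_sderive_tfield v ps pu)).
  rewrite (sderiveE (is_sderive_tfield u ps pv)).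
  by rewrite ![dot _ p]dotC pu pv !scale0r !add0r dotC subrr.
rewrite LC_tfield ?b0 /tangent ?dot0r // scaler0 oppr0 subr0.
by rewrite opprK addrC [dot v w]dotC [dot u w]dotC.
Qed.

End SphereGeometry.

(** * Tension and bitension of quadratic forms *)

Section PolarForm.
Variables (R : realType) (m n : nat) (A : 'I_n.+1 -> 'M[R]_m.+1).
Hypothesis Asym : forall k, (A k)^T = A k.
Implicit Types (x y u v w : 'rV[R]_m.+1).

Definition polar x y : 'rV[R]_n.+1 := \row_k dot (x *m A k) y.

Lemma polarC x y : polar x y = polar y x.
Proof. by apply/rowP => k; rewrite !mxE dot_mulmx Asym dotC. Qed.

Lemma polarDl x y w : polar (x + y) w = polar x w + polar y w.
Proof. by apply/rowP => k; rewrite !mxE mulmxDl dotDl. Qed.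

Lemma polarZl a x w : polar (a *: x) w = a *: polar x w.
Proof. by apply/rowP => k; rewrite !mxE -scalemxAl dotZl. Qed.

Lemma polarDr x y w : polar w (x + y) = polar w x + polar w y.
Proof. by apply/rowP => k; rewrite !mxE dotDr. Qed.

Lemma polarZr a x w : polar w (a *: x) = a *: polar w x.
Proof. by apply/rowP => k; rewrite !mxE dotZr. Qed.

Lemma polarNl x w : polar (- x) w = - polar x w.
Proof. by rewrite -scaleN1r polarZl scaleN1r. Qed.

Lemma polarNr x w : polar w (- x) = - polar w x.
Proof. by rewrite -scaleN1r polarZr scaleN1r. Qed.

Definition polarE := (polarDl, polarDr, polarZl, polarZr, polarNl, polarNr).

Lemma polar_sumr (I : finType) (f : I -> 'rV[R]_m.+1) w :
  polar w (\sum_i f i) = \sum_i polar w (f i).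
Proof.
apply: (big_morph (polar w)) => [x y|]; first exact: polarDr.
by rewrite -(scale0r 0) polarZr scale0r.
Qed.

Lemma is_sderive_polar (f g : 'rV[R]_m.+1 -> 'rV[R]_m.+1) x u df dg :
  esphere m 1 x -> is_sderive 1 f x u df -> is_sderive 1 g x u dg ->
  is_sderive 1 (fun y => polar (f y) (g y)) x u
    (polar df (g x) + polar (f x) dg).
Proof.
move=> xs ff gg; apply/is_derive_rVP => k; rewrite !mxE.
have fA : is_sderive 1 (fun y => f y *m A k) x u (df *m A k).
  apply/is_derive_rVP => j.
  have row_dot (v : 'rV[R]_m.+1) : (v *m A k) 0 j = dot v (row j (A k)^T).
    by rewrite mxE; apply: eq_bigr => i _; rewrite !mxE.
  have D := is_sderive_dot ltr01 xs ff (is_sderive_cst 1 x u (row j (A k)^T)).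
  rewrite row_dot (_ : (fun y => _) =
      (fun y => dot (f (sretract 1 y)) (row j (A k)^T))); last first.
    by apply/funext => y; rewrite row_dot.
  by apply: is_derive_eq D _; rewrite dot0r addr0.
rewrite (_ : (fun y => _) = (fun y =>
    dot (f (sretract 1 y) *m A k) (g (sretract 1 y)))); last first.
  by apply/funext => y; rewrite mxE.
have D := is_sderive_dot ltr01 xs fA gg.
exact: D.
Qed.

Definition polar_trace : 'rV[R]_n.+1 :=
  \sum_i polar (delta_mx 0 i) (delta_mx 0 i).

Lemma sum_coord x : \sum_i x 0 i *: delta_mx 0 i = x.
Proof. by rewrite [RHS]matrix_sum_delta big_ord1. Qed.

(** The tangential trace is the full trace less the normal direction [x]: writing
    [P e_i = e_i - x_i x], the cross terms sum to [-2 b x x] and the last terms to [b x x]. *)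
Lemma sum_polar_tproj x : esphere m 1 x ->
  \sum_i polar (tproj x (delta_mx 0 i)) (tproj x (delta_mx 0 i)) =
  polar_trace - polar x x.
Proof.
move=> /(esphereP ltr01) xx.
have s1 : \sum_i x 0 i *: polar x (delta_mx 0 i) = polar x x.
  rewrite -[X in _ = polar _ X](sum_coord x) polar_sumr; apply: eq_bigr => i _.
  by rewrite polarZr.
have s2 : \sum_(i < m.+1) (x 0 i * x 0 i) *: polar x x = polar x x.
  by rewrite -scaler_suml -/(dot x x) xx expr1n scale1r.
transitivity (polar_trace - 2 *: polar x x + polar x x); last first.
  by apply/rowP => k; rewrite !mxE; ring.
rewrite -{1}s1 -s2 scaler_sumr -sumrB -big_split; apply: eq_bigr => i _ /=.
rewrite /tproj !polarE [dot _ x]dotC dot_delta [polar (delta_mx 0 i) x]polarC.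
by apply/rowP => k; rewrite !mxE; ring.
Qed.

End PolarForm.

(** * Norm identities and tension field of a quadratic form *)

Section QuadraticForm.
Variables (R : realType) (m n : nat) (A : 'I_n.+1 -> 'M[R]_m.+1).
Variables (phi : 'rV[R]_m.+1 -> 'rV[R]_n.+1).
Hypothesis Asym : forall k, (A k)^T = A k.
Hypothesis phiE : forall x, esphere m 1 x -> phi x = polar A x x.
Hypothesis phi_sphere : forall x, esphere m 1 x -> esphere n 1 (phi x).
Implicit Types (x y u v w e : 'rV[R]_m.+1).
Local Notation b := (polar A).

(** Both sides are homogeneous of degree four, so the identity spreads from the unit sphere to all
    of the space. *)
Lemma dot_quad x : dot (b x x) (b x x) = dot x x ^+ 2.
Proof.
have [->|x0] := eqVneq x 0.
  by rewrite -(scale0r 0) polarZl !dotZl !mul0r expr2 mul0r.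
have xs := sretract_in ltr01 x0.
have /(esphereP ltr01) := phi_sphere xs.
rewrite phiE // /sretract !(polarE, dotE).
move: x0; rewrite -enorm_gt0 => x0 E.
have n0 : enorm x != 0 by rewrite gt_eqF.
rewrite -(enorm_sqr x).
transitivity (enorm x ^+ 4 * (1 / enorm x * (1 / enorm x * (1 / enorm x *
    (1 / enorm x * dot (b x x) (b x x)))))); first by field.
by rewrite E; ring.
Qed.

Lemma dot_quad_line (t : R) x u :
  dot (b x x) (b x x) + 4 * t * dot (b x x) (b x u)
  + t ^+ 2 * (4 * dot (b x u) (b x u) + 2 * dot (b x x) (b u u))
  + 4 * t ^+ 3 * dot (b x u) (b u u) + t ^+ 4 * dot (b u u) (b u u)
  = (dot x x + 2 * t * dot x u + t ^+ 2 * dot u u) ^+ 2.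
Proof.
have := dot_quad (x + t *: u); rewrite !(polarE, dotE) [b u x]polarC //.
rewrite [dot u x]dotC [dot (b u u) (b x x)]dotC [dot (b u u) (b x u)]dotC.
rewrite [dot (b x u) (b x x)]dotC => E.
transitivity ((dot x x + t * dot x u +
  (t * dot x u + t * (t * dot u u))) ^+ 2); last by ring.
by rewrite -E; ring.
Qed.

(** Comparison of the coefficients of [t] in [dot_quad_line]; the values at [1, -1, 2, -2] separate
    [t] from [t ^+ 3]. *)
Lemma dot_quad_polar x u : dot (b x x) (b x u) = dot x u * dot x x.
Proof.
have := dot_quad_line 1 x u; have := dot_quad_line (-1) x u.
have := dot_quad_line 2 x u; have := dot_quad_line (-2) x u.
have := dot_quad x; have := dot_quad u; nra.
Qed.

(** Comparison of the coefficients of [t ^+ 2]: adding the values at [1] and [-1] cancels the odd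
    powers. *)
Lemma dot_polar_polar x u :
  4 * dot (b x u) (b x u) + 2 * dot (b x x) (b u u) =
  4 * dot x u ^+ 2 + 2 * dot x x * dot u u.
Proof.
have := dot_quad_line 1 x u; have := dot_quad_line (-1) x u.
have := dot_quad x; have := dot_quad u; nra.
Qed.

Lemma tangent_polar x u : esphere m 1 x -> tangent x u ->
  tangent (phi x) (b x u).
Proof. by move=> xs xu; rewrite /tangent phiE // dot_quad_polar xu mul0r. Qed.

Lemma is_sderive_phi x u : esphere m 1 x -> tangent x u ->
  is_sderive 1 phi x u (2 *: b x u).
Proof.
move=> xs xu; have did := is_sderive_id ltr01 xs xu.
apply: (is_sderive_ext ltr01 xs phiE).
apply: is_derive_eq (is_sderive_polar A xs did did) _.
by rewrite polarC // scalerDl scale1r.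
Qed.

Lemma pushforward_phi (X : vfield R m) x : esphere m 1 x -> tangent x (X x) ->
  pushforward phi X x = 2 *: b x (X x).
Proof. by move=> xs xX; exact: sderiveE (is_sderive_phi xs xX). Qed.

Lemma is_sderive_pushforward e x u : esphere m 1 x -> tangent x u ->
  is_sderive 1 (pushforward phi (tfield e)) x u
    (2 *: (b u (tproj x e) - dot e x *: b x u - dot e u *: phi x)).
Proof.
move=> xs xu; have did := is_sderive_id ltr01 xs xu.
have D := is_sderiveZ 2 (is_sderive_polar A xs did (is_sderive_tfield e xs xu)).
have E y : esphere m 1 y ->
    pushforward phi (tfield e) y = 2 *: b y (tfield e y).
  by move=> ys; apply: pushforward_phi => //; exact: tangent_tproj.
apply: (is_sderive_ext ltr01 xs E).
apply: is_derive_eq D _; congr (_ *: _).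
by rewrite phiE // !polarE opprD addrA.
Qed.

Lemma pushforward_LC e x : esphere m 1 x ->
  pushforward phi (LC (tfield e) (tfield e)) x =
  - (2 * dot e x) *: b x (tproj x e).
Proof.
move=> xs; have xe := tangent_tproj e xs.
rewrite pushforward_phi // !LC_tfield // ?polarNr ?polarZr.
  by rewrite scaleNr scalerN scalerA.
by rewrite /tangent dotNr dotZr xe mulr0 oppr0.
Qed.

(** In the derivative of the push-forward, the part along [phi x] is normal, and the part along
    [b x (tproj x e)] is cancelled by the Levi-Civita correction. *)
Lemma second_fundamental_formE e x : esphere m 1 x ->
  second_fundamental_form phi (tfield e) (tfield e) x =
  2 *: tproj (phi x) (b (tproj x e) (tproj x e)).
Proof.
move=> xs; have xe := tangent_tproj e xs.
rewrite /second_fundamental_form /pullback_conn.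
rewrite (sderiveE (is_sderive_pushforward e xs xe)) tprojZ.
rewrite -!scaleNr !tprojD !tprojZ (tproj_self (phi_sphere xs)) scaler0 addr0.
rewrite (tproj_tangent (tangent_polar xs xe)) pushforward_LC //.
by apply/rowP => k; rewrite !mxE; ring.
Qed.

Lemma tproj_sum p (I : finType) (f : I -> 'rV[R]_n.+1) :
  tproj p (\sum_i f i) = \sum_i tproj p (f i).
Proof.
by apply: (big_morph (tproj p)) => [x y|]; rewrite ?tprojD ?tproj0.
Qed.

Lemma tensionE x : esphere m 1 x ->
  tension phi x = 2 *: tproj (phi x) (polar_trace A).
Proof.
move=> xs; rewrite /tension /strace.
rewrite (eq_bigr _ (fun i _ => second_fundamental_formE (delta_mx 0 i) xs)).
rewrite -scaler_sumr -tproj_sum sum_polar_tproj // -phiE //.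
by rewrite tprojD -scaleN1r tprojZ (tproj_self (phi_sphere xs)) scaler0 addr0.
Qed.

End QuadraticForm.

Lemma sqrt_half (R : realType) :
  Num.sqrt (1 - (1 / Num.sqrt 2) ^+ 2) = 1 / Num.sqrt 2 :> R.
Proof.
have s2 : Num.sqrt 2 ^+ 2 = 2 :> R by rewrite sqr_sqrtr ?ler0n.
rewrite expr_div_n s2 expr1n (_ : 1 - 1 / 2 = (1 / Num.sqrt 2) ^+ 2).
  by rewrite sqrtr_sqr ger0_norm // divr_ge0 ?sqrtr_ge0.
by rewrite expr_div_n s2; field.
Qed.

(** * Bitension field and dilation of a homothetic quadratic form *)

Section HomotheticQuadraticForm.
Variables (R : realType) (m n : nat) (A : 'I_n.+1 -> 'M[R]_m.+1).
Variables (phi : 'rV[R]_m.+1 -> 'rV[R]_n.+1) (c : R).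
Hypothesis Asym : forall k, (A k)^T = A k.
Hypothesis phiE : forall x, esphere m 1 x -> phi x = polar A x x.
Hypothesis phi_sphere : forall x, esphere m 1 x -> esphere n 1 (phi x).
Hypothesis phi_hom : forall x u v,
  esphere m 1 x -> tangent x u -> tangent x v ->
  dot (sderive 1 phi x u) (sderive 1 phi x v) = c * dot u v.
Implicit Types (x y u v w e : 'rV[R]_m.+1).
Local Notation b := (polar A).

Lemma hom_polar x u v : esphere m 1 x -> tangent x u -> tangent x v ->
  4 * dot (b x u) (b x v) = c * dot u v.
Proof.
move=> xs xu xv; rewrite -(phi_hom xs xu xv).
rewrite (sderiveE (is_sderive_phi Asym phiE xs xu)).
rewrite (sderiveE (is_sderive_phi Asym phiE xs xv)) !dotE; ring.
Qed.

Lemma sum_dot_tproj x : esphere m 1 x ->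
  \sum_i dot (tproj x (delta_mx 0 i)) (tproj x (delta_mx 0 i)) = m%:R.
Proof.
move=> xs; have /(esphereP ltr01) xx := xs.
rewrite (eq_bigr (fun i => 1 - x 0 i * x 0 i)); last first.
  by move=> i _; rewrite dot_tproj // !dot_delta mxE !eqxx expr2.
rewrite sumrB -/(dot x x) xx sumr_const card_ord expr1n.
by rewrite -[m.+1]addn1 natrD addrK.
Qed.

(** The constant value of [dot (phi x) (polar_trace A)] on the sphere. *)
Definition trace_level : R := m.+1%:R - c * m%:R / 2.

(* Summing [4 |b(x,u)|^2 + 2 <phi x, q u> = 2 |u|^2] over a frame. *)
Lemma dot_phi_trace x : esphere m 1 x ->
  dot (phi x) (polar_trace A) = trace_level.
Proof.
move=> xs; have /(esphereP ltr01) xx := xs.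
have /(esphereP ltr01) pp := phi_sphere xs.
pose P (i : 'I_m.+1) := tproj x (delta_mx 0 i).
have PE i : dot (phi x) (b (P i) (P i)) = (1 - c / 2) * dot (P i) (P i).
  have xP : tangent x (P i) by exact: tangent_tproj.
  have := dot_polar_polar Asym phiE phi_sphere x (P i).
  rewrite hom_polar // xP xx -phiE //; lra.
have : dot (phi x) (\sum_i b (P i) (P i)) = (1 - c / 2) * m%:R.
  by rewrite dot_sumr (eq_bigr _ (fun i _ => PE i)) -mulr_sumr sum_dot_tproj.
rewrite sum_polar_tproj // dotDr dotNr -phiE // pp /trace_level -natr1; lra.
Qed.

(** Homogeneity turns [dot_phi_trace] into the value [trace_level * dot y y] at every [y];
    polarizing gives [trace_level * dot x u], which is zero here. *)
Lemma dot_polar_trace x u : esphere m 1 x -> tangent x u ->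
  dot (b x u) (polar_trace A) = 0.
Proof.
move=> xs xu; have xs0 := esphere_neq0 ltr01 xs.
have hom y : dot (b y y) (polar_trace A) = trace_level * dot y y.
  have [->|y0] := eqVneq y 0.
    by rewrite -(scale0r 0) polarZl !dotZl !mul0r mulr0.
  have ys := sretract_in ltr01 y0.
  have := dot_phi_trace ys; rewrite phiE // /sretract !(polarE, dotE).
  move: y0; rewrite -enorm_gt0 => y0 <-; rewrite -(enorm_sqr y).
  by field; rewrite gt_eqF.
have := hom (x + u); have := hom x; have := hom u.
rewrite !(polarE, dotE) xu [dot u x]dotC xu [b u x]polarC //; lra.
Qed.

Lemma tension_hom x : esphere m 1 x ->
  tension phi x = 2 *: (polar_trace A - trace_level *: phi x).
Proof.
move=> xs; rewrite (tensionE Asym phiE) // /tproj.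
by rewrite [dot _ (phi x)]dotC dot_phi_trace.
Qed.

(** By [tension_hom] the tension field is a constant minus [2 * trace_level] times [phi], and the
    differential of [phi] is already tangent at [phi x]. *)
Lemma pullback_conn_tension (X : vfield R m) x :
  esphere m 1 x -> tangent x (X x) ->
  pullback_conn phi X (tension phi) x =
  (- 2 * trace_level) *: pushforward phi X x.
Proof.
move=> xs xX; have D := is_sderive_phi Asym phiE xs xX.
have D' := is_sderiveZ 2 (is_sderiveB (is_sderive_cst 1 x (X x) (polar_trace A))
  (is_sderiveZ trace_level D)).
rewrite /pullback_conn (sderiveE (is_sderive_ext ltr01 xs tension_hom D')).
rewrite (pushforward_phi Asym phiE) // tproj_tangent.
  by apply/rowP => k; rewrite !mxE; ring.
have := tangent_polar Asym phiE phi_sphere xs xX; rewrite /tangent => E.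
by rewrite !dotE dot0r E !mulr0 subrr mulr0.
Qed.

(** First covariant derivatives of the tension field are [- 2 * trace_level] times push-forwards, so
    the second ones are that multiple of the second fundamental form. *)
Lemma rough_laplacian_tension x : esphere m 1 x ->
  rough_laplacian phi (tension phi) x = (2 * trace_level) *: tension phi x.
Proof.
move=> xs; rewrite /rough_laplacian {2}/tension /strace -sumrN scaler_sumr.
apply: eq_bigr => i _; set e := delta_mx 0 i.
have xe := tangent_tproj e xs.
have D := is_sderiveZ (- 2 * trace_level)
  (is_sderive_pushforward Asym phiE e xs xe).
have E y : esphere m 1 y -> pullback_conn phi (tfield e) (tension phi) y =
    (- 2 * trace_level) *: pushforward phi (tfield e) y.
  by move=> ys; apply: pullback_conn_tension => //; exact: tangent_tproj.
rewrite /second_cov_derivative pullback_conn_tension //; last first.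
  by rewrite LC_tfield // /tangent dotNr dotZr xe mulr0 oppr0.
rewrite {1}/pullback_conn (sderiveE (is_sderive_ext ltr01 xs E D)).
rewrite /second_fundamental_form {1}/pullback_conn.
rewrite (sderiveE (is_sderive_pushforward Asym phiE e xs xe)).
by rewrite [in LHS]tprojZ -scalerBr -scaleNr; congr (_ *: _); ring.
Qed.

(** The tension field is orthogonal to the image of the differential, so each curvature term is the
    tension field times minus the squared length of the image of [P i]; these squared lengths add up
    to [c * m]. *)
Lemma bitension_hom x : esphere m 1 x ->
  bitension phi x = (c * m%:R - 2 * trace_level) *: tension phi x.
Proof.
move=> xs; rewrite /bitension rough_laplacian_tension // /strace.
pose P (i : 'I_m.+1) := tproj x (delta_mx 0 i).
have ts : tangent (phi x) (tension phi x).
  have /(esphereP ltr01) pp := phi_sphere xs.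
  by rewrite /tangent tension_hom // !dotE dot_phi_trace // pp expr1n; ring.
rewrite (eq_bigr (fun i => - (c * dot (P i) (P i)) *: tension phi x));
  last first.
  move=> i _; have xP : tangent x (P i) by exact: tangent_tproj.
  have pE : pushforward phi (tfield (delta_mx 0 i)) x = 2 *: b x (P i).
    exact: pushforward_phi.
  have tP : tangent (phi x) (2 *: b x (P i)).
    by rewrite /tangent dotZr (tangent_polar Asym phiE phi_sphere xs xP) mulr0.
  rewrite pE curvatureE //; last exact: phi_sphere.
  have -> : dot (tension phi x) (2 *: b x (P i)) = 0.
    rewrite tension_hom // !dotE [dot (polar_trace A) _]dotC dot_polar_trace //.
    by rewrite (tangent_polar Asym phiE phi_sphere xs xP); ring.
  rewrite scale0r sub0r dotZl dotZr -(hom_polar xs xP xP) -scaleNr.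
  by congr (_ *: _); ring.
rewrite -scaler_suml sumrN -mulr_sumr sum_dot_tproj //.
by apply/rowP => i; rewrite !mxE; ring.
Qed.

(** The factor in [bitension_hom] is [2 (c m - (m + 1))]; it must vanish as soon as the tension
    field is nonzero at one point. *)
Lemma proper_biharmonic_dilation :
  (exists x y, [/\ esphere m 1 x, esphere m 1 y & phi x <> phi y]) ->
  proper_biharmonic phi <-> c * m%:R = m.+1%:R.
Proof.
move=> [x [y [xs ys xy]]].
have bE := bitension_hom.
have tE := tension_hom.
split=> [[bi nharm]|cm].
  have /existsNP[z /not_implyP[zs /eqP tz]] := nharm.
  have /eqP := bi z zs; rewrite bE // scaler_eq0 (negPf tz) orbF => /eqP.
  rewrite /trace_level; lra.
(* At this dilation the level is [(m + 1) / 2]; being nonzero, it would make a harmonic [phi]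
   constant. *)
have h0 : trace_level != 0.
  rewrite /trace_level cm (_ : _ - _ = m.+1%:R / 2); last by field.
  by rewrite mulf_neq0 // ?invr_eq0 pnatr_eq0.
split=> [z' zs'|harm].
  by rewrite bE // /trace_level cm (_ : _ - _ = 0) ?scale0r //; field.
have phi_cst z : esphere m 1 z -> phi z = trace_level^-1 *: polar_trace A.
  move=> zs; have /eqP := harm z zs; rewrite tE // scaler_eq0 pnatr_eq0 /=.
  by rewrite subr_eq0 => /eqP ->; rewrite scalerA mulVf // scale1r.
by apply: xy; rewrite !phi_cst.
Qed.

(** Both [nu] and the trace [T] have constant product with [phi], so fullness gives
    [trace_level *: nu = t *: T]. Pairing with [nu], where [dot nu T = (m + 1) t], yields
    [trace_level = (m + 1) / 2]. *)
Lemma dilation_of_small_hypersphere (nu : 'rV[R]_n.+1) :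
  full_map phi -> enorm nu = 1 ->
  phi @` esphere m 1 `<=` small_hypersphere nu (1 / Num.sqrt 2) ->
  c * m%:R = m.+1%:R.
Proof.
move=> full /(esphereP ltr01) nu1 sub.
set t : R := 1 / Num.sqrt 2 in sub *.
have t2 : t ^+ 2 = 1 / 2 by rewrite expr_div_n sqr_sqrtr ?ler0n // expr1n.
have phinu x : esphere m 1 x -> dot (phi x) nu = t.
  move=> xs; have [_] : small_hypersphere nu t (phi x) by apply: sub; exists x.
  by rewrite sqrt_half.
have es (i : 'I_m.+1) : esphere m 1 ('e_i : 'rV[R]_m.+1).
  by apply/(esphereP ltr01); rewrite dot_delta mxE !eqxx expr1n.
have sumT (v : 'rV[R]_n.+1) (d : R) :
    (forall x, esphere m 1 x -> dot (phi x) v = d) ->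
    dot v (polar_trace A) = m.+1%:R * d.
  move=> phid; rewrite /polar_trace dot_sumr (eq_bigr (fun=> d)) => [|i _].
    by rewrite sumr_const card_ord mulr_natl.
  by rewrite -phiE // dotC phid.
have Tnu := sumT _ _ phinu.
(* [full_map] applies since [phi] is orthogonal to this vector. *)
have E : trace_level *: nu - t *: polar_trace A = 0.
  apply/eqP/negPn/negP => /full; apply=> x xs.
  by rewrite !dotE dot_phi_trace // phinu //; ring.
have hnu : trace_level * 1 = t * (m.+1%:R * t).
  apply/eqP; rewrite -subr_eq0 -Tnu -(expr1n _ 2) -nu1 //.
  by rewrite -(dotZr trace_level) -(dotZr t) -dotNr -dotDr E dot0r.
move: hnu; rewrite mulrCA -expr2 t2 /trace_level; lra.
Qed.

End HomotheticQuadraticForm.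

(** * Representation of a quadratic form by symmetric matrices *)

Lemma quadratic_form_polar (R : realType) (m n : nat)
    (phi : 'rV[R]_m.+1 -> 'rV[R]_n.+1) : quadratic_form phi ->
  exists A : 'I_n.+1 -> 'M[R]_m.+1,
    [/\ forall k, (A k)^T = A k,
        forall x, esphere m 1 x -> phi x = polar A x x
      & forall x, esphere m 1 x -> esphere n 1 (phi x)].
Proof.
move=> [[F [[a aF] Fs phiF]] _].
(* Averaging the coefficients with their transposes symmetrizes them and changes no value of the
   form. *)
exists (fun k => \matrix_(i, j) ((a k i j + a k j i) / 2)); split.
- by move=> k; apply/matrixP => i j; rewrite !mxE addrC.
- move=> x xs; rewrite phiF //; apply/rowP => k; rewrite aF mxE.
  pose S := \sum_i \sum_j a k i j * x 0 i * x 0 j.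
  have S' : \sum_i \sum_j a k j i * x 0 i * x 0 j = S.
    by rewrite exchange_big; do 2![apply: eq_bigr => ? _]; rewrite mulrAC.
  rewrite -/S (_ : S = (S + S) / 2); last by field.
  rewrite -{2}S' -big_split mulr_suml.
  transitivity (\sum_i \sum_j ((a k i j + a k j i) / 2) * x 0 i * x 0 j).
    apply: eq_bigr => i _; rewrite -big_split mulr_suml.
    by apply: eq_bigr => j _ /=; ring.
  rewrite exchange_big; apply: eq_bigr => j _.
  by rewrite mxE mulr_suml; apply: eq_bigr => i _; rewrite mxE; ring.
- by move=> x xs; rewrite /esphere /= phiF // Fs.
Qed.

(** * The Veronese map *)

Section Scaling.
Variable R : realType.

Lemma is_derive_scalev (k : nat) (a : R) (x u : 'rV[R]_k.+1) :
  is_derive x u (fun y : 'rV[R]_k.+1 => a *: y) (a *: u).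
Proof. exact: is_deriveZ (is_derive_id x u). Qed.

Lemma Ck_on_cst (k l N : nat) (U : set 'rV[R]_k.+1) (w : 'rV[R]_l.+1) :
  Ck_on N U (fun=> w).
Proof.
elim: N w => [|N IH] w /=; first by move=> x _; exact: cst_continuous.
move=> v; split=> [x _|]; first exact: derivable_cst.
rewrite (_ : 'D_v (fun=> w) = fun=> 0) //.
by apply/funext => x; exact: derive_cst.
Qed.

Lemma smooth_scale (k : nat) (r a : R) :
  smooth_on_sphere r (fun y : 'rV[R]_k.+1 => a *: y).
Proof.
exists setT, (fun y => a *: y); split => //; first exact: openT.
case=> [x _|N v] /=; first exact: scaler_continuous.
split=> [x _|]; first by have [] := is_derive_scalev a x v.
rewrite (_ : 'D_v _ = fun=> a *: v); first exact: Ck_on_cst.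
by apply/funext => x; have [_] := is_derive_scalev a x v.
Qed.

Lemma homothetic_diffeo_scale (k : nat) (r s : R) : 0 < r -> 0 < s ->
  homothetic_diffeo r s (fun y : 'rV[R]_k.+1 => (s / r) *: y).
Proof.
move=> r0 s0; have rs : 0 < s / r by rewrite divr_gt0.
have [rn sn] : r != 0 /\ s != 0 by rewrite !gt_eqF.
split.
  exists (fun y => (r / s) *: y); split; try exact: smooth_scale.
    move=> x xr; split.
      by rewrite /esphere /= enormZ ?(ltW rs) // xr divfK.
    by rewrite scalerA (_ : _ * _ = 1) ?scale1r //; field; rewrite rn sn.
  move=> x xr; split.
    by rewrite /esphere /= enormZ ?xr ?divfK // divr_ge0 // ltW.
  by rewrite scalerA (_ : _ * _ = 1) ?scale1r //; field; rewrite rn sn.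
exists ((s / r) ^+ 2); first by rewrite exprn_gt0.
move=> x u v xr xu xv.
rewrite (sderiveE (is_sderiveZ (s / r) (is_sderive_id r0 xr xu))).
rewrite (sderiveE (is_sderiveZ (s / r) (is_sderive_id r0 xr xv))).
by rewrite dotZl dotZr mulrA expr2.
Qed.

End Scaling.

Section Veronese.
Variable R : realType.

Lemma sum5 (V : zmodType) (f : 'I_5 -> V) :
  \sum_(i < 5) f i = f 0 + f 1 + f 2 + f 3 + f 4.
Proof.
rewrite !big_ord_recl big_ord0 addr0 !addrA.
by do ![congr (_ + _)]; congr f; apply/val_inj.
Qed.

Lemma sum3 (V : zmodType) (f : 'I_3 -> V) :
  \sum_(i < 3) f i = f 0 + f 1 + f 2.
Proof.
rewrite !big_ord_recl big_ord0 addr0 !addrA.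
by do ![congr (_ + _)]; congr f; apply/val_inj.
Qed.

(** At [dot p p = 3] the value is [1]: the sphere of radius [Num.sqrt 3] goes to the unit sphere. *)
Lemma dot_veronese (p : 'rV[R]_3) :
  dot (veronese p) (veronese p) = dot p p ^+ 2 / 9.
Proof.
have s0 : Num.sqrt 3 != 0 :> R by rewrite sqrtr_eq0 -ltNge ltr0n.
have s3 : Num.sqrt 3 ^+ 2 = 3 :> R by rewrite sqr_sqrtr ?ler0n.
rewrite /dot sum5 sum3 !mxE /=.
by rewrite -!expr2 !(expr_div_n, exprMn) s3; field.
Qed.

End Veronese.

(** * Gram matrix of the coefficients and the orthonormal frame of the Veronese map *)

Section VeroneseFrame.
Variables (R : realType) (n : nat) (A : 'I_n.+1 -> 'M[R]_3).
Variables (phi : 'rV[R]_3 -> 'rV[R]_n.+1) (c : R).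
Hypothesis Asym : forall k, (A k)^T = A k.
Hypothesis phiE : forall x, esphere 2 1 x -> phi x = polar A x x.
Hypothesis phi_sphere : forall x, esphere 2 1 x -> esphere n 1 (phi x).
Hypothesis phi_hom : forall x u v,
  esphere 2 1 x -> tangent x u -> tangent x v ->
  dot (sderive 1 phi x u) (sderive 1 phi x v) = c * dot u v.
Hypothesis c_half3 : c * 2%:R = 3%:R.

Local Notation q i j := (polar A 'e_i 'e_j).

Lemma dot_e (i j : 'I_3) : dot 'e_i 'e_j = (i == j)%:R :> R.
Proof. by rewrite dot_delta mxE eqxx eq_sym. Qed.

Lemma e_sphere (i : 'I_3) : esphere 2 1 ('e_i : 'rV[R]_3).
Proof. by apply/(esphereP ltr01); rewrite dot_e eqxx expr1n. Qed.

Lemma trace_level_half3 : trace_level 2 c = 3 / 2.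
Proof. rewrite /trace_level; have := c_half3; lra. Qed.

Lemma q_trace : polar_trace A = q 0 0 + q 1 1 + q 2 2.
Proof. by rewrite /polar_trace sum3. Qed.

Lemma dot_qii_qij i j : i != j -> dot (q i i) (q i j) = 0.
Proof.
move=> /negPf ij; rewrite (dot_quad_polar Asym phiE phi_sphere).
by rewrite dot_e ij mul0r.
Qed.

(** Homothety at the base point ['e_i], where ['e_j] and ['e_k] are tangent, with [c = 3 / 2]. *)
Lemma dot_qij_qik i j k : i != j -> i != k ->
  dot (q i j) (q i k) = 3 / 8 * (j == k)%:R.
Proof.
move=> /negPf ij /negPf ik.
have : 4 * dot (q i j) (q i k) = c * dot 'e_j 'e_k.
  apply: (hom_polar Asym phiE phi_hom); first exact: e_sphere.
    by rewrite /tangent dot_e ij.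
  by rewrite /tangent dot_e ik.
rewrite dot_e (_ : c = 3 / 2); last by have := c_half3; lra.
set d : R := (j == k)%:R; lra.
Qed.

(** Off the diagonal, [dot_polar_polar] reads [4 * (3 / 8) + 2 * dot (q i i) (q j j) = 2]. *)
Lemma dot_qii_qjj i j : dot (q i i) (q j j) = if i == j then 1 else 1 / 4.
Proof.
have [<-|ij] := eqVneq i j.
  rewrite -phiE ?(esphereP ltr01 _).1 ?expr1n //; last exact: e_sphere.
  by apply: phi_sphere; exact: e_sphere.
have := dot_polar_polar Asym phiE phi_sphere 'e_i 'e_j.
rewrite dot_qij_qik // !dot_e !eqxx (negPf ij) /=; lra.
Qed.

Lemma dot_qij_trace i j : i != j -> dot (q i j) (polar_trace A) = 0.
Proof.
move=> /negPf ij.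
apply: (dot_polar_trace Asym phiE phi_sphere phi_hom); first exact: e_sphere.
by rewrite /tangent dot_e ij.
Qed.

Lemma I3_not_uniq (i j k l : 'I_3) : uniq [:: i; j; k; l] = false.
Proof.
apply/negP => /card_uniqP cu.
by have := max_card (mem [:: i; j; k; l]); rewrite cu card_ord.
Qed.

(** Two pairs out of three indices always meet; symmetry of the polar form brings the common index
    first, where [dot_qij_qik] applies. *)
Lemma dot_qij_qkl i j k l : i != j -> k != l -> dot (q i j) (q k l) =
  if (i == k) && (j == l) || (i == l) && (j == k) then 3 / 8 else 0.
Proof.
move=> ij kl.
have [ik|ik] := eqVneq i k.
  rewrite -ik in kl *; rewrite dot_qij_qik // (negPf kl) /= orbF.
  by case: eqP => _ /=; rewrite ?mulr1 ?mulr0.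
have [il|il] := eqVneq i l.
  rewrite -il in kl *; rewrite [q k i]polarC // dot_qij_qik //.
  by rewrite /=; case: eqP => _ /=; rewrite ?mulr1 ?mulr0.
have [jk|jk] := eqVneq j k.
  rewrite -jk in kl *; rewrite [q i j]polarC // dot_qij_qik //.
    by rewrite (negPf il) mulr0.
  by rewrite eq_sym.
have [jl|jl] := eqVneq j l.
  rewrite -jl in kl *; rewrite [q i j]polarC // [q k j]polarC // dot_qij_qik //.
    by rewrite (negPf ik) mulr0.
  by rewrite eq_sym.
have := I3_not_uniq i j k l.
by rewrite /= !inE !negb_or ij ik il jk jl kl.
Qed.

(** For distinct indices, [q j k] is orthogonal to the trace [q i i + q j j + q k k] and to its last
    two terms, hence to the first. *)
Lemma dot_qii_qjk i j k : j != k -> dot (q i i) (q j k) = 0.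
Proof.
have [<-|ij] := eqVneq i j; first exact: dot_qii_qij.
move=> jk.
have [->|ik] := eqVneq i k.
  by rewrite [q j k]polarC // dot_qii_qij // eq_sym.
have := dot_qij_trace jk.
have -> : polar_trace A = q i i + (q j j + q k k).
  rewrite /polar_trace (bigD1 i) //= (bigD1 j) 1?eq_sym //=.
  rewrite (bigD1 k) /= ?big1 ?addr0 //; last by rewrite eq_sym ik eq_sym jk.
  move=> l /andP[/andP[li lj] lk]; have := I3_not_uniq l i j k.
  by rewrite /= !inE !negb_or li lj lk ij ik jk.
rewrite ![dot (q j k) _]dotC !dotDl dot_qii_qij // [q j k]polarC //.
by rewrite dot_qii_qij 1?eq_sym // !addr0.
Qed.

(* The coefficients of phi on the trace-free quadrics xy, xz, yz,
   (x^2 - y^2)/2 and (x^2 + y^2 - 2 z^2)/(2 sqrt 3). *)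
Definition frame_row (i : 'I_5) : 'rV[R]_n.+1 :=
  nth 0 [:: 2 *: q 0 1; 2 *: q 0 2; 2 *: q 1 2; q 0 0 - q 1 1;
    - Num.sqrt 3 *: (q 2 2 - 3^-1 *: polar_trace A)] i.

Lemma dot_qij_qkk i j k : i != j -> dot (q i j) (q k k) = 0.
Proof. by move=> ij; rewrite dotC dot_qii_qjk. Qed.

Lemma dot_frame_trace i : dot (frame_row i) (polar_trace A) = 0.
Proof.
rewrite q_trace /frame_row q_trace.
case: i => -[|[|[|[|[|]]]]] //= _;
rewrite !dotE ?dot_qii_qjj ?dot_qii_qjk // ?dot_qij_qkk //=; try lra.

Qed.

(** The scalings in [frame_row] equalize the squared lengths: [4 * (3 / 8)] for the mixed terms,
    [1 + 1 - 2 / 4] for the difference, [3 * (1 / 2)] for the last row. *)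
Lemma dot_frame i j : dot (frame_row i) (frame_row j) = 3 / 2 * (i == j)%:R.
Proof.
have s3 : Num.sqrt 3 * Num.sqrt 3 = 3 :> R by rewrite -expr2 sqr_sqrtr ?ler0n.
rewrite /frame_row q_trace.
case: i => -[|[|[|[|[|?]]]]] //= hi; case: j => -[|[|[|[|[|?]]]]] //= hj;
rewrite !dotE ?dot_qii_qjj ?dot_qii_qjk // ?dot_qij_qkk // ?dot_qij_qkl //=;
try lra.

Qed.
Lemma trace_sqr : dot (polar_trace A) (polar_trace A) = 9 / 2.
Proof.
rewrite {1}q_trace !dotDl -!phiE; try exact: e_sphere.
rewrite !(dot_phi_trace Asym phiE phi_sphere phi_hom); try exact: e_sphere.
rewrite trace_level_half3; lra.
Qed.

(** By [trace_sqr] the trace has length [3 / sqrt 2]. The centre of the small sphere is a third of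
    the trace, at distance [1 / sqrt 2] from the origin. *)
Definition unit_center : 'rV[R]_n.+1 := (Num.sqrt 2 / 3) *: polar_trace A.

Definition coord_frame : 'M[R]_(5, n.+1) :=
  \matrix_(i < 5) ((Num.sqrt 2 / Num.sqrt 3) *: frame_row i).

(** The unit sphere is enlarged to radius [sqrt 3], mapped to the unit sphere, then shrunk to radius
    [1 / sqrt 2]. *)
Definition veronese_coords (x : 'rV[R]_3) : 'rV[R]_5 :=
  (1 / Num.sqrt 2) *: veronese (Num.sqrt 3 *: x).

Let sq2 : Num.sqrt 2 ^+ 2 = 2 :> R. Proof. by rewrite sqr_sqrtr ?ler0n. Qed.
Let sq3 : Num.sqrt 3 ^+ 2 = 3 :> R. Proof. by rewrite sqr_sqrtr ?ler0n. Qed.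
Let s2n0 : Num.sqrt 2 != 0 :> R. Proof. by rewrite sqrtr_eq0 -ltNge ltr0n. Qed.
Let s3n0 : Num.sqrt 3 != 0 :> R. Proof. by rewrite sqrtr_eq0 -ltNge ltr0n. Qed.

Lemma dot_center : dot unit_center unit_center = 1.
Proof.
rewrite !dotE trace_sqr mulrA -expr2 expr_div_n sq2; lra.
Qed.

Lemma frame_orthonormal : coord_frame *m coord_frame^T = 1%:M.
Proof.
apply/matrixP => i j; rewrite !mxE.
transitivity (dot (row i coord_frame) (row j coord_frame)).
  by apply: eq_bigr => k _; rewrite !mxE.
rewrite !rowK !dotE dot_frame mulrA -expr2 expr_div_n sq2 sq3.
by case: eqP => _ /=; field.
Qed.

Lemma frame_center : coord_frame *m unit_center^T = 0.
Proof.
apply/colP => i; rewrite !mxE.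
transitivity (dot (row i coord_frame) unit_center).
  by apply: eq_bigr => k _; rewrite !mxE.
by rewrite rowK !dotE dot_frame_trace !mulr0.
Qed.

Lemma quad_coords x : polar A x x =
  (x 0 0 ^+ 2) *: q 0 0 + (x 0 1 ^+ 2) *: q 1 1 + (x 0 2 ^+ 2) *: q 2 2
  + (2 * x 0 0 * x 0 1) *: q 0 1 + (2 * x 0 0 * x 0 2) *: q 0 2
  + (2 * x 0 1 * x 0 2) *: q 1 2.
Proof.
rewrite -{1 2}(sum_coord x) sum3 !polarE // [q 1 0]polarC // [q 2 0]polarC //.
by rewrite [q 2 1]polarC //; apply/rowP => k; rewrite !mxE; ring.
Qed.

Lemma phi_frame x : esphere 2 1 x ->
  phi x = veronese_coords x *m coord_frame + (1 / Num.sqrt 2) *: unit_center.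
Proof.
move=> xs; have := (esphereP ltr01 _).1 xs; rewrite {1}/dot sum3 => xx.
rewrite phiE // quad_coords mulmx_sum_row sum5 !rowK.
rewrite /frame_row /unit_center /= q_trace; apply/rowP => k; rewrite !mxE /=.
(* In this form the factors [Num.sqrt 3] of the rescaled argument cancel under [field]. *)
rewrite (_ : 6 = 2 * Num.sqrt 3 ^+ 2); last by rewrite sq3; ring.
set t : R := Num.sqrt 2; set T := dot _ _ + _ + _.
(* Multiplying the constant part [T / 3] by [dot x x = 1] makes both sides quadratic in [x]. *)
have -> : 1 / t * (t / 3 * T) =
    (x 0 0 * x 0 0 + x 0 1 * x 0 1 + x 0 2 * x 0 2) * T / 3.
  by rewrite xx; field.
by rewrite /T; field; rewrite s2n0 s3n0.
Qed.

Lemma veronese_coords_sphere x : esphere 2 1 x ->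
  esphere 4 (1 / Num.sqrt 2) (veronese_coords x).
Proof.
move=> /(esphereP ltr01) xs.
apply/esphereP; first by rewrite divr_gt0 ?sqrtr_gt0.
rewrite !dotE dot_veronese !dotE xs.
transitivity ((Num.sqrt 3 ^+ 2) ^+ 2 / (9 * Num.sqrt 2 ^+ 2) : R).
  by field.
by rewrite expr_div_n sq3 sq2; field.
Qed.

(** The frame and the centre form [5 + 1] orthonormal rows whose span contains every value of [phi].
    By fullness no nonzero vector is orthogonal to them all, so they number [n + 1]. *)
Lemma frame_full : full_map phi -> n = 5%N.
Proof.
move=> full; pose M := col_mx coord_frame unit_center.
have nn : unit_center *m unit_center^T = 1%:M.
  apply/rowP => i; by rewrite !ord1 -dot_mx dot_center mxE.
have MM : M *m M^T = 1%:M.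
  rewrite tr_col_mx mul_col_row frame_orthonormal frame_center nn.
  rewrite -[unit_center *m _]trmxK trmx_mul trmxK frame_center trmx0.
  by rewrite -scalar_mx_block.
have rM : row_free M by apply/row_freeP; exists M^T.
have rMT : row_free M^T.
  apply: inj_row_free => v; rewrite tr_col_mx mul_mx_row => /eqP.
  rewrite row_mx_eq0 => /andP[/eqP vE /eqP vN].
  apply/eqP/negPn/negP => /full; apply=> x xs.
  rewrite phi_frame // dotDl dotZl dot_mulmx vE dot0r add0r.
  have -> : dot unit_center v = (v *m unit_center^T) 0 0.
    by rewrite dotC dot_mx.
  by rewrite vN mxE mulr0.
move: rM rMT; rewrite /row_free mxrank_tr => /eqP -> /eqP; by case.
Qed.

End VeroneseFrame.

(** The scalings of [veronese_coords] are undone by division by [sqrt 3] in the domain and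
    multiplication by [sqrt 2] in the codomain. *)
Lemma veronese_coords_up_to_homothety (R : realType) :
  veronese_up_to_homothety (l := 4) (1 / Num.sqrt 2) (@veronese_coords R).
Proof.
have s2 : 0 < Num.sqrt 2 :> R by rewrite sqrtr_gt0.
have s3 : 0 < Num.sqrt 3 :> R by rewrite sqrtr_gt0.
exists (fun x => (1 / Num.sqrt 3) *: x).
exists (fun y => (1 / (1 / Num.sqrt 2)) *: y).
split; [exact: homothetic_diffeo_scale| |].
  by apply: homothetic_diffeo_scale; rewrite ?divr_gt0.
move=> x _; rewrite /veronese_coords !scalerA !div1r invrK.
by rewrite !mulfV ?gt_eqF // !scale1r.
Qed.

(** * Characterization of the proper biharmonic maps *)

Theorem theorem3p7 (R : realType) (n : nat) (phi : 'rV[R]_3 -> 'rV[R]_n.+1)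
  (hquad : quadratic_form phi) (hfull : full_map phi) (hhom : homothetic 1 phi) :
  proper_biharmonic phi <->
  n = 5%N /\
  exists nu : 'rV[R]_n.+1,
    [/\ enorm nu = 1,
        phi @` esphere 2 1 `<=` small_hypersphere nu (1 / Num.sqrt 2)
      & exists (E : 'M[R]_(n.-1.+1, n.+1)) (psi : 'rV[R]_3 -> 'rV[R]_n.-1.+1),
          hypersphere_coordinates nu (1 / Num.sqrt 2) E phi psi /\
          veronese_up_to_homothety (1 / Num.sqrt 2) psi].
Proof.
have [A [Asym phiE phis]] := quadratic_form_polar hquad.
have [_ nconst] := hquad; have [c _ phih] := hhom.
have s2 : 0 < Num.sqrt 2 :> R by rewrite sqrtr_gt0.
(* Both sides are compared with the single equation [c * 2 = 3]. *)
apply: (iff_trans (proper_biharmonic_dilation Asym phiE phis phih nconst)).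
split=> [c3|[_ [nu [nu1 sub _]]]]; last first.
  exact: (dilation_of_small_hypersphere Asym phiE phis phih hfull nu1 sub).
(* Substituting [n] makes [n.-1.+1] reduce to [5], the number of rows of [coord_frame]. *)
have n5 := frame_full Asym phiE phis phih c3 hfull; subst n.
split=> //; exists (unit_center A); split.
- by apply/(enormE _ ler01); rewrite (dot_center Asym phiE phis phih) // expr1n.
- move=> _ [x xs <-]; split; first exact: phis.
  (* The height is [sqrt 2 / 3] times the level [3 / 2], that is [1 / sqrt 2]. *)
  rewrite sqrt_half dotZr (dot_phi_trace Asym phiE phis phih) //.
  rewrite trace_level_half3 //.
  transitivity (Num.sqrt 2 ^+ 2 / (2 * Num.sqrt 2) : R).
    by field; rewrite gt_eqF.
  by rewrite sqr_sqrtr ?ler0n //; field; rewrite gt_eqF.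
- exists (coord_frame A), (@veronese_coords R); split.
    split; [exact: frame_orthonormal phih c3|exact: frame_center phih c3|].
    move=> x xs; split; first exact: veronese_coords_sphere.
    by rewrite sqrt_half; exact: phi_frame.
  exact: veronese_coords_up_to_homothety.
Qed.
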